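(* Let $\mathcal{A}$ and $\mathcal{B}$ be abelian categories with enough projective and enough injective objects, $T:\mathcal{B}\to\mathcal{A}$ a right exact covariant functor, and $n\geqslant 1$ an integer. Then the following statements hold. (1) For every object $X$ of $\mathcal{A}$ and every object $\begin{pmatrix}N_1\\ N_2\end{pmatrix}_{\varphi}$ of the comma category $(T\downarrow\mathcal{A})$, $$\mathrm{Ext}_{(T\downarrow\mathcal{A})}^{n}\left(\begin{pmatrix}X\\ 0\end{pmatrix}_{0},\begin{pmatrix}N_1\\ N_2\end{pmatrix}_{\varphi}\right)\cong\mathrm{Ext}_{\mathcal{A}}^{n}(X,N_1).$$ (2) Let $Y$ be an object of $\mathcal{B}$ and $\begin{pmatrix}X_1\\ X_2\end{pmatrix}_{\psi}$ an object of $(T\downarrow\mathcal{A})$. If $(\mathrm{L}_jT)Y=0$ for each $1\leqslant j\leqslant n$, then, for each $1\leqslant j\leqslant n$, $$\mathrm{Ext}_{(T\downarrow\mathcal{A})}^{j}\left(\begin{pmatrix}T(Y)\\ Y\end{pmatrix}_{1},\begin{pmatrix}X_1\\ X_2\end{pmatrix}_{\psi}\right)\cong\mathrm{Ext}_{\mathcal{B}}^{j}(Y,X_2).$$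
   Context: Objects of the comma category $(T\downarrow\mathcal{A})$ are triples $\begin{pmatrix}A\\ B\end{pmatrix}_{\varphi}$ with $A\in\mathcal{A}$, $B\in\mathcal{B}$ and $\varphi:T(B)\to A$ a morphism in $\mathcal{A}$; morphisms from $\begin{pmatrix}A\\ B\end{pmatrix}_{\varphi}$ to $\begin{pmatrix}A'\\ B'\end{pmatrix}_{\varphi'}$ are pairs $(a:A\to A',\,b:B\to B')$ with $\varphi' T(b)=a\varphi$. This category is abelian, and a short sequence in it is exact if and only if it is exact in both components. $\begin{pmatrix}X\\ 0\end{pmatrix}_{0}$ denotes the object with second component zero and zero structure map, and $\begin{pmatrix}T(Y)\\ Y\end{pmatrix}_{1}$ denotes the object whose structure map is the identity of $T(Y)$. $\mathrm{L}_jT$ is the $j$-th left derived functor of $T$, computed by applying $T$ to a deleted projective resolution. *)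

(* Defs.v *)
From HB Require Import structures.
From mathcomp Require Import all_boot all_algebra.
From mathcomp Require Import boolp.

Set Implicit Arguments.
Unset Strict Implicit.
Unset Printing Implicit Defensive.

Import GRing.Theory.
Local Open Scope ring_scope.

(** Classically every abelian group carries a [zmodType] structure (decidable
    equality and choice come from the axioms of [boolp]), so taking morphism
    groups in [zmodType] is no restriction. *)
Record preadditive := Preadditive {
  obj :> Type;
  hom : obj -> obj -> zmodType;
  idm : forall X, hom X X;
  comp : forall X Y Z, hom Y Z -> hom X Y -> hom X Z;
  compA : forall W X Y Z (h : hom Y Z) (g : hom X Y) (f : hom W X),
    comp h (comp g f) = comp (comp h g) f;
  comp1m : forall X Y (f : hom X Y), comp (idm Y) f = f;
  compm1 : forall X Y (f : hom X Y), comp f (idm X) = f;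
  compDl : forall X Y Z (g h : hom Y Z) (f : hom X Y),
    comp (g + h) f = comp g f + comp h f;
  compDr : forall X Y Z (h : hom Y Z) (f g : hom X Y),
    comp h (f + g) = comp h f + comp h g }.

Arguments hom {_} _ _.
Arguments idm {_} _.
Arguments comp {_ _ _ _} _ _.
Arguments compA {_ _ _ _ _} _ _ _.
Arguments comp1m {_ _ _} _.
Arguments compm1 {_ _ _} _.
Arguments compDl {_ _ _ _} _ _ _.
Arguments compDr {_ _ _ _} _ _ _.

Notation "g \oc f" := (comp g f) (at level 40, left associativity).

Section Universal.
Variable C : preadditive.
Implicit Types X Y Z K Q : C.

Definition mono X Y (f : hom X Y) : Prop :=
  forall Z (g h : hom Z X), f \oc g = f \oc h -> g = h.

Definition epi X Y (f : hom X Y) : Prop :=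
  forall Z (g h : hom Y Z), g \oc f = h \oc f -> g = h.

Definition is_zero Z : Prop :=
  forall X, (forall f : hom X Z, f = 0) /\ (forall f : hom Z X, f = 0).

Definition is_kernel X Y (f : hom X Y) K (k : hom K X) : Prop :=
  f \oc k = 0 /\
  forall Z (x : hom Z X), f \oc x = 0 -> exists! y : hom Z K, k \oc y = x.

Definition is_cokernel X Y (f : hom X Y) Q (q : hom Y Q) : Prop :=
  q \oc f = 0 /\
  forall Z (y : hom Y Z), y \oc f = 0 -> exists! z : hom Q Z, z \oc q = y.

Definition is_biproduct X Y Z (i1 : hom X Z) (i2 : hom Y Z)
    (p1 : hom Z X) (p2 : hom Z Y) : Prop :=
  [/\ p1 \oc i1 = idm X, p2 \oc i2 = idm Y, p1 \oc i2 = 0, p2 \oc i1 = 0 &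
      i1 \oc p1 + i2 \oc p2 = idm Z].

Record abelian : Prop := Abelian {
  ab_zero : exists Z, is_zero Z;
  ab_biproduct : forall X Y, exists Z (i1 : hom X Z) (i2 : hom Y Z)
    (p1 : hom Z X) (p2 : hom Z Y), is_biproduct i1 i2 p1 p2;
  ab_kernel : forall X Y (f : hom X Y), exists K (k : hom K X), is_kernel f k;
  ab_cokernel : forall X Y (f : hom X Y),
    exists Q (q : hom Y Q), is_cokernel f q;
  ab_normal_mono : forall X Y (f : hom X Y), mono f ->
    exists Z (g : hom Y Z), is_kernel g f;
  ab_normal_epi : forall X Y (f : hom X Y), epi f ->
    exists Z (g : hom Z X), is_cokernel g f }.

Definition is_image X Y (f : hom X Y) K (k : hom K Y) : Prop :=
  exists Q (q : hom Y Q), is_cokernel f q /\ is_kernel q k.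

(** Exactness at [Y]: the image of [f] and the kernel of [g] are the same
    subobject of [Y]. *)
Definition exact X Y Z (f : hom X Y) (g : hom Y Z) : Prop :=
  exists K (k : hom K Y), is_image f k /\ is_kernel g k.

Definition projective P : Prop :=
  forall X Y (e : hom X Y) (f : hom P Y), epi e ->
  exists g : hom P X, e \oc g = f.

Definition injective_obj I : Prop :=
  forall X Y (m : hom X Y) (f : hom X I), mono m ->
  exists g : hom Y I, g \oc m = f.

Definition enough_projectives : Prop :=
  forall X, exists P (p : hom P X), projective P /\ epi p.

Definition enough_injectives : Prop :=
  forall X, exists I (m : hom X I), injective_obj I /\ mono m.

End Universal.

Record abelianCat := AbelianCat {
  acat :> preadditive;
  acatP : abelian acat }.

Section PreadditiveTheory.
Variable C : preadditive.
Implicit Types X Y Z : C.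

Lemma comp0m X Y Z (f : hom X Y) : (0 : hom Y Z) \oc f = 0.
Proof. by apply: (@addrI _ (0 \oc f)); rewrite -compDl !addr0. Qed.

Lemma compm0 X Y Z (f : hom Y Z) : f \oc (0 : hom X Y) = 0.
Proof. by apply: (@addrI _ (f \oc 0)); rewrite -compDr !addr0. Qed.

Lemma compNl X Y Z (g : hom Y Z) (f : hom X Y) : (- g) \oc f = - (g \oc f).
Proof. by apply: (@addrI _ (g \oc f)); rewrite -compDl !subrr comp0m. Qed.

Lemma compNr X Y Z (g : hom Y Z) (f : hom X Y) : g \oc (- f) = - (g \oc f).
Proof. by apply: (@addrI _ (g \oc f)); rewrite -compDr !subrr compm0. Qed.

Lemma compBl X Y Z (g h : hom Y Z) (f : hom X Y) :
  (g - h) \oc f = g \oc f - h \oc f.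
Proof. by rewrite compDl compNl. Qed.

Lemma compBr X Y Z (h : hom Y Z) (f g : hom X Y) :
  h \oc (f - g) = h \oc f - h \oc g.
Proof. by rewrite compDr compNr. Qed.

Lemma monoP X Y (f : hom X Y) :
  (forall Z (g : hom Z X), f \oc g = 0 -> g = 0) -> mono f.
Proof.
move=> f0 Z g h fgh; apply/eqP; rewrite -subr_eq0; apply/eqP; apply: f0.
by rewrite compBr fgh subrr.
Qed.

Lemma epiP X Y (f : hom X Y) :
  (forall Z (g : hom Y Z), g \oc f = 0 -> g = 0) -> epi f.
Proof.
move=> f0 Z g h fgh; apply/eqP; rewrite -subr_eq0; apply/eqP; apply: f0.
by rewrite compBl fgh subrr.
Qed.

Lemma mono0 X Y (f : hom X Y) Z (g : hom Z X) : mono f -> f \oc g = 0 -> g = 0.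
Proof. by move=> fM fg; apply: fM; rewrite compm0. Qed.

Lemma epi0 X Y (f : hom X Y) Z (g : hom Y Z) : epi f -> g \oc f = 0 -> g = 0.
Proof. by move=> fE fg; apply: fE; rewrite comp0m. Qed.

Lemma kernel_mono X Y (f : hom X Y) K (k : hom K X) : is_kernel f k -> mono k.
Proof.
move=> [fk kU] Z g h kgh.
have [|y [_ yU]] := kU Z (k \oc g); first by rewrite compA fk comp0m.
by rewrite -(yU g) // -(yU h).
Qed.

Lemma cokernel_epi X Y (f : hom X Y) Q (q : hom Y Q) : is_cokernel f q -> epi q.
Proof.
move=> [qf qU] Z g h gqh.
have [|y [_ yU]] := qU Z (g \oc q); first by rewrite -compA qf compm0.
by rewrite -(yU g) // -(yU h).
Qed.

Lemma kernel_lift X Y (f : hom X Y) K (k : hom K X) Z (x : hom Z X) :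
  is_kernel f k -> f \oc x = 0 -> exists y : hom Z K, k \oc y = x.
Proof. by move=> [_ kU] /kU [y [ky _]]; exists y. Qed.

Lemma cokernel_desc X Y (f : hom X Y) Q (q : hom Y Q) Z (y : hom Y Z) :
  is_cokernel f q -> y \oc f = 0 -> exists z : hom Q Z, z \oc q = y.
Proof. by move=> [_ qU] /qU [z [zq _]]; exists z. Qed.

Lemma is_kernelI X Y (f : hom X Y) K (k : hom K X) :
  mono k -> f \oc k = 0 ->
  (forall Z (x : hom Z X), f \oc x = 0 -> exists y : hom Z K, k \oc y = x) ->
  is_kernel f k.
Proof.
move=> kM fk kU; split=> // Z x /kU [y ky]; exists y; split=> // y' ky'.
by apply: kM; rewrite ky ky'.
Qed.

Lemma is_cokernelI X Y (f : hom X Y) Q (q : hom Y Q) :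
  epi q -> q \oc f = 0 ->
  (forall Z (y : hom Y Z), y \oc f = 0 -> exists z : hom Q Z, z \oc q = y) ->
  is_cokernel f q.
Proof.
move=> qE qf qU; split=> // Z y /qU [z zq]; exists z; split=> // z' zq'.
by apply: qE; rewrite zq zq'.
Qed.

Lemma exact_comp0 X Y Z (f : hom X Y) (g : hom Y Z) : exact f g -> g \oc f = 0.
Proof.
move=> [K [k [[Q [q [[qf _] qk]]] [gk _]]]].
by have [y <-] := kernel_lift qk qf; rewrite compA gk comp0m.
Qed.

Lemma kernel_of_cokernel X Y (f : hom X Y) Q (q : hom Y Q) :
  abelian C -> mono f -> is_cokernel f q -> is_kernel q f.
Proof.
move=> CA fM fq; have [Z [g gf]] := ab_normal_mono CA fM.
apply: is_kernelI => //; first by case: fq.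
have [g' gE] := cokernel_desc fq (proj1 gf).
by move=> W x qx; apply: (kernel_lift gf); rewrite -gE -compA qx compm0.
Qed.

Lemma cokernel_of_kernel X Y (f : hom X Y) K (k : hom K X) :
  abelian C -> epi f -> is_kernel f k -> is_cokernel k f.
Proof.
move=> CA fE fk; have [Z [g gf]] := ab_normal_epi CA fE.
apply: is_cokernelI => //; first by case: fk.
have [g' gE] := kernel_lift fk (proj1 gf).
by move=> W x xk; apply: (cokernel_desc gf); rewrite -gE compA xk comp0m.
Qed.

Lemma exact_cover X Y (f : hom X Y) K (k : hom K X) P (e : hom P K) :
  abelian C -> is_kernel f k -> epi e -> exact (k \oc e) f.
Proof.
move=> CA fk eE; exists K, k; split=> //.
have [Q [q qk]] := ab_cokernel CA k; exists Q, q; split; last first.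
  by apply: kernel_of_cokernel => //; apply: kernel_mono fk.
apply: is_cokernelI; first exact: cokernel_epi qk.
  by rewrite compA (proj1 qk) comp0m.
move=> Z y; rewrite compA => /(epi0 eE); exact: cokernel_desc.
Qed.

Lemma cokernel_exact X Y (f : hom X Y) Q (q : hom Y Q) :
  abelian C -> is_cokernel f q -> exact f q.
Proof.
move=> CA fq; have [K [k qk]] := ab_kernel CA q.
by exists K, k; split=> //; exists Q, q.
Qed.

Lemma exact_cokernel X Y Z (f : hom X Y) (g : hom Y Z) :
  abelian C -> exact f g -> epi g -> is_cokernel f g.
Proof.
move=> CA fg gE; have gf := exact_comp0 fg.
case: fg => K [k [[Q [q [fq qk]]] gk]].
apply: is_cokernelI => // W y yf.
apply: (cokernel_desc (cokernel_of_kernel CA gE gk)).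
by have [y' <-] := cokernel_desc fq yf; rewrite -compA (proj1 qk) compm0.
Qed.

End PreadditiveTheory.

Record additive_functor (C D : preadditive) := AdditiveFunctor {
  fobj :> C -> D;
  fmor : forall X Y, hom X Y -> hom (fobj X) (fobj Y);
  fmor1 : forall X, fmor (idm X) = idm (fobj X);
  fmorM : forall X Y Z (g : hom Y Z) (f : hom X Y),
    fmor (g \oc f) = fmor g \oc fmor f;
  fmorD : forall X Y (f g : hom X Y), fmor (f + g) = fmor f + fmor g }.

Arguments fmor {C D} _ {X Y} _.

Section FunctorTheory.
Variables (C D : preadditive) (T : additive_functor C D).

Lemma fmor0 X Y : fmor T (0 : hom X Y) = 0.
Proof. by apply: (@addrI _ (fmor T 0)); rewrite -fmorD !addr0. Qed.

Lemma fmorN X Y (f : hom X Y) : fmor T (- f) = - fmor T f.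
Proof. by apply: (@addrI _ (fmor T f)); rewrite -fmorD !subrr fmor0. Qed.

Definition right_exact : Prop :=
  forall X Y Z (f : hom X Y) (g : hom Y Z), exact f g -> epi g ->
  exact (fmor T f) (fmor T g) /\ epi (fmor T g).

Lemma fobj_zero Z : is_zero Z -> is_zero (T Z).
Proof.
move=> Z0; have id0 : idm (T Z) = 0 by rewrite -fmor1 ((Z0 Z).1 (idm Z)) fmor0.
move=> X; split=> f; first by rewrite -[f]comp1m id0 comp0m.
by rewrite -[f]compm1 id0 compm0.
Qed.

Lemma right_exact_cokernel X Y Z (f : hom X Y) (q : hom Y Z) :
  abelian C -> abelian D -> right_exact ->
  is_cokernel f q -> is_cokernel (fmor T f) (fmor T q).
Proof.
move=> CA DA TR fq.
have [Tfq TqE] := TR _ _ _ _ _ (cokernel_exact CA fq) (cokernel_epi fq).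
exact: exact_cokernel.
Qed.

Lemma right_exact_epi X Y (f : hom X Y) :
  abelian C -> right_exact -> epi f -> epi (fmor T f).
Proof.
move=> CA TR fE; have [Z [g gf]] := ab_normal_epi CA fE.
exact: (TR _ _ _ _ _ (cokernel_exact CA gf) fE).2.
Qed.

End FunctorTheory.

Record projective_resolution (C : preadditive) (X : C) := ProjectiveResolution {
  pr_obj :> nat -> C;
  pr_d : forall i, hom (pr_obj i.+1) (pr_obj i);
  pr_aug : hom (pr_obj 0) X;
  pr_projective : forall i, projective (pr_obj i);
  pr_exact : forall i, exact (pr_d i.+1) (pr_d i);
  pr_exact0 : exact (pr_d 0) pr_aug;
  pr_epi : epi pr_aug }.

Section Resolution.
Variable C : abelianCat.
Hypothesis CP : enough_projectives C.

Record cover_arrow := CoverArrow {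
  ca_src : C;
  ca_tgt : C;
  ca_mor : hom ca_src ca_tgt;
  ca_proj : projective ca_src }.

Lemma exists_cover_step (s : cover_arrow) :
  exists P (d : hom P (ca_src s)), projective P /\ exact d (ca_mor s).
Proof.
have [K [k sk]] := ab_kernel (acatP C) (ca_mor s).
have [P [p [Pp pE]]] := CP K; exists P, (k \oc p); split=> //.
exact: exact_cover (acatP C) sk pE.
Qed.

Lemma exists_resolution (X : C) : inhabited (projective_resolution X).
Proof.
have step (s : cover_arrow) :
    {P : C & {d : hom P (ca_src s) | projective P /\ exact d (ca_mor s)}}.
  by have [P /cid[d H]] := cid (exists_cover_step s); exists P, d.
have [P0 [p0 [P0p p0E]]] := CP X.
pose next s := CoverArrow (projT1 (projT2 (step s)))
                          (proj1 (projT2 (projT2 (step s)))).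
pose s n := iter n next (CoverArrow p0 P0p).
have next_exact t : exact (ca_mor (next t)) (ca_mor t).
  exact: proj2 (projT2 (projT2 (step t))).
constructor; unshelve eapply ProjectiveResolution.
- by move=> n; exact: ca_src (s n).
- by move=> n; exact: ca_mor (s n.+1).
- exact: p0.
- by move=> n; exact: ca_proj.
- by move=> n; exact: next_exact (s n.+1).
- exact: next_exact (s 0%N).
- exact: p0E.
Qed.

Definition resolution (X : C) : projective_resolution X :=
  inhabited_witness (exists_resolution X).

End Resolution.

Section Choices.
Variable C : abelianCat.

(** [Ext] and left derived functors are built from projective resolutions,
    kernels, cokernels and zero objects picked by classical choice; other
    choices give isomorphic results. *)
Definition zero_obj : C := projT1 (cid (ab_zero (acatP C))).

Lemma zero_objP : is_zero zero_obj.
Proof. exact: projT2 (cid (ab_zero (acatP C))). Qed.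

Section Kernel.
Variables (X Y : C) (f : hom X Y).

Definition kernel_obj : C := projT1 (cid (ab_kernel (acatP C) f)).
Definition kernel_mor : hom kernel_obj X :=
  projT1 (cid (projT2 (cid (ab_kernel (acatP C) f)))).

Lemma kernelP : is_kernel f kernel_mor.
Proof. exact: projT2 (cid (projT2 (cid (ab_kernel (acatP C) f)))). Qed.

Definition cokernel_obj : C := projT1 (cid (ab_cokernel (acatP C) f)).
Definition cokernel_mor : hom Y cokernel_obj :=
  projT1 (cid (projT2 (cid (ab_cokernel (acatP C) f)))).

Lemma cokernelP : is_cokernel f cokernel_mor.
Proof. exact: projT2 (cid (projT2 (cid (ab_cokernel (acatP C) f)))). Qed.

End Kernel.

Section Homology.
Variables (X Y Z : C) (f : hom X Y) (g : hom Y Z) (gf0 : g \oc f = 0).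

Definition cycle_lift : hom X (kernel_obj g) :=
  projT1 (cid (kernel_lift (kernelP g) gf0)).

Lemma cycle_liftP : kernel_mor g \oc cycle_lift = f.
Proof. exact: projT2 (cid (kernel_lift (kernelP g) gf0)). Qed.

Definition homology : C := cokernel_obj cycle_lift.

End Homology.

(** The deleted resolution [... -> P 1 -> P 0 -> 0], shifted by one so that
    [deleted P n.+1] is [P n]. *)
Section Deleted.
Variables (X : C) (P : projective_resolution X).

Definition deleted (n : nat) : C := if n is m.+1 then P m else zero_obj.

Definition deleted_d (n : nat) : hom (deleted n.+1) (deleted n) :=
  match n return hom (deleted n.+1) (deleted n) with
  | 0 => 0
  | m.+1 => pr_d P m
  end.

Lemma deleted_dd n : deleted_d n \oc deleted_d n.+1 = 0.
Proof.
by case: n => [|n]; [exact: comp0m | exact: exact_comp0 (pr_exact P n)].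
Qed.

End Deleted.
End Choices.

Section LeftDerived.
Variables (C D : abelianCat) (CP : enough_projectives C).
Variable T : additive_functor C D.

Lemma fmor_deleted_dd (X : C) (P : projective_resolution X) n :
  fmor T (deleted_d P n) \oc fmor T (deleted_d P n.+1) = 0.
Proof. by rewrite -fmorM deleted_dd fmor0. Qed.

Definition left_derived (n : nat) (Y : C) : D :=
  homology (fmor_deleted_dd (resolution CP Y) n).

End LeftDerived.

Section GroupCohomology.
Variables (U V W : zmodType) (f : {additive U -> V}) (g : {additive V -> W}).

Definition cocycle_pred : {pred V} := fun v => g v == 0.

Fact cocycle_closed : zmod_closed cocycle_pred.
Proof.
split=> [|x y]; rewrite !unfold_in ?raddf0 //.
by move=> /eqP gx /eqP gy; rewrite raddfB gx gy subrr.
Qed.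

HB.instance Definition _ := GRing.isZmodClosed.Build V cocycle_pred
  cocycle_closed.

Definition cocycle := {v : V | v \in cocycle_pred}.
HB.instance Definition _ := SubChoice.on cocycle.
HB.instance Definition _ := [SubChoice_isSubZmodule of cocycle by <:].

Definition coboundary_pred : {pred cocycle} :=
  fun z => `[< exists u, f u = val z >].

Fact coboundary_closed : zmod_closed coboundary_pred.
Proof.
split=> [|x y]; rewrite !unfold_in; first by apply/asboolP; exists 0; rewrite !raddf0.
move=> /asboolP[u fu] /asboolP[v fv]; apply/asboolP; exists (u - v).
by rewrite !raddfB /= fu fv.
Qed.

HB.instance Definition _ := GRing.isZmodClosed.Build cocycle coboundary_pred
  coboundary_closed.

(** [ker g / (ker g :&: im f)], which is [ker g / im f] when [g \o f = 0]. *)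
Definition group_cohomology : zmodType := Quotient.quot coboundary_pred.

End GroupCohomology.

Section Precomp.
Variables (C : preadditive) (X Y N : C) (d : hom X Y).

Definition precomp (f : hom Y N) : hom X N := f \oc d.

Fact precomp_is_zmod_morphism : zmod_morphism precomp.
Proof. by move=> f g; rewrite /precomp compBl. Qed.

HB.instance Definition _ := GRing.isZmodMorphism.Build (hom Y N) (hom X N)
  precomp precomp_is_zmod_morphism.

End Precomp.

Arguments precomp {C X Y} N d f.

(** [Ext CP n X N] is the [n]-th cohomology group of [Hom(P, N)], [P] being the
    deleted form of the chosen projective resolution of [X]. *)
Definition Ext (C : abelianCat) (CP : enough_projectives C) (n : nat)
    (X N : C) : zmodType :=
  let P := resolution CP X in
  group_cohomology (precomp N (deleted_d P n)) (precomp N (deleted_d P n.+1)).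

Definition group_iso (U V : zmodType) : Prop :=
  exists f : {additive U -> V}, bijective f.

Section Comma.
Variables (A B : preadditive) (T : additive_functor B A).

Record comma_obj := CommaObj {
  cfst : A;
  csnd : B;
  cmap : hom (T csnd) cfst }.

Section Hom.
Variables x y : comma_obj.

Definition comma_pred : {pred hom (cfst x) (cfst y) * hom (csnd x) (csnd y)} :=
  fun ab => cmap y \oc fmor T ab.2 == ab.1 \oc cmap x.

Fact comma_closed : zmod_closed comma_pred.
Proof.
split=> [|[a b] [a' b']]; rewrite !unfold_in /=.
  by rewrite fmor0 compm0 comp0m.
move=> /eqP ab /eqP ab'.
by rewrite fmorD fmorN compBr compBl ab ab'.
Qed.

HB.instance Definition _ := GRing.isZmodClosed.Build _ comma_pred comma_closed.

Definition comma_hom :=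
  {ab : hom (cfst x) (cfst y) * hom (csnd x) (csnd y) | ab \in comma_pred}.
HB.instance Definition _ := SubChoice.on comma_hom.
HB.instance Definition _ := [SubChoice_isSubZmodule of comma_hom by <:].

Lemma comma_homP (f : comma_hom) :
  cmap y \oc fmor T (val f).2 = (val f).1 \oc cmap x.
Proof. exact/eqP/(valP f). Qed.

Lemma comma_pairP (a : hom (cfst x) (cfst y)) (b : hom (csnd x) (csnd y)) :
  cmap y \oc fmor T b = a \oc cmap x -> (a, b) \in comma_pred.
Proof. by move=> ab; apply/eqP. Qed.

Definition comma_mk (a : hom (cfst x) (cfst y)) (b : hom (csnd x) (csnd y))
    (ab : cmap y \oc fmor T b = a \oc cmap x) : comma_hom :=
  exist _ (a, b) (comma_pairP ab).

Lemma comma_hom_eq (f g : comma_hom) :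
  (val f).1 = (val g).1 -> (val f).2 = (val g).2 -> f = g.
Proof.
move=> fg1 fg2; apply: val_inj.
by case: (val f) (val g) fg1 fg2 => [a b] [a' b'] /= -> ->.
Qed.

End Hom.

Definition comma_id (x : comma_obj) : comma_hom x x.
Proof.
by apply: (@comma_mk x x (idm _) (idm _)); rewrite fmor1 compm1 comp1m.
Defined.

Definition comma_comp x y z (g : comma_hom y z) (f : comma_hom x y) :
  comma_hom x z.
Proof.
apply: (@comma_mk x z ((val g).1 \oc (val f).1) ((val g).2 \oc (val f).2)).
by rewrite fmorM compA comma_homP -compA comma_homP compA.
Defined.

Definition comma : preadditive.
Proof.
apply: (@Preadditive comma_obj comma_hom comma_id comma_comp).
- by move=> *; apply: comma_hom_eq; rewrite /= compA.
- by move=> *; apply: comma_hom_eq; rewrite /= comp1m.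
- by move=> *; apply: comma_hom_eq; rewrite /= compm1.
- by move=> *; apply: comma_hom_eq; rewrite /= compDl.
- by move=> *; apply: comma_hom_eq; rewrite /= compDr.
Defined.

Lemma comma_eq1 (x y : comma) (f g : hom x y) : f = g -> (val f).1 = (val g).1.
Proof. by move=> ->. Qed.

Lemma comma_eq2 (x y : comma) (f g : hom x y) : f = g -> (val f).2 = (val g).2.
Proof. by move=> ->. Qed.

Definition comma_unit (Y : B) : comma := @CommaObj (T Y) Y (idm (T Y)).

End Comma.

Arguments comma_mk {A B T x y} a b ab.

Section CommaAbelian.
Variables (A B : abelianCat) (T : additive_functor B A).
Hypothesis TR : right_exact T.
Let AA : abelian A := acatP A.
Let BA : abelian B := acatP B.

Definition comma_left (X : A) : comma T :=
  @CommaObj A B T X (zero_obj B) 0.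

Lemma zero_objl (Y : B) (f : hom Y (zero_obj B)) : f = 0.
Proof. exact: (@zero_objP B Y).1. Qed.

Lemma zero_objr (Y : B) (f : hom (zero_obj B) Y) : f = 0.
Proof. exact: (@zero_objP B Y).2. Qed.

Lemma fobj_zero_objr (X : A) (f : hom (T (zero_obj B)) X) : f = 0.
Proof. exact: ((fobj_zero T (@zero_objP B)) X).2. Qed.

Lemma comma_kernel (x y k : comma T) (f : hom x y) (i : hom k x) :
  is_kernel (val f).1 (val i).1 -> is_kernel (val f).2 (val i).2 ->
  is_kernel f i.
Proof.
move=> i1 i2; apply: is_kernelI.
- move=> z g h igh; apply: comma_hom_eq.
    by apply: (kernel_mono i1); apply: (comma_eq1 igh).
  by apply: (kernel_mono i2); apply: (comma_eq2 igh).
- by apply: comma_hom_eq => /=; [case: i1 | case: i2].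
move=> z u fu.
have [a aE] := kernel_lift i1 (comma_eq1 fu).
have [b bE] := kernel_lift i2 (comma_eq2 fu).
have ab : cmap k \oc fmor T b = a \oc cmap z.
  apply: (kernel_mono i1); rewrite compA -comma_homP -compA -fmorM bE.
  by rewrite comma_homP compA aE.
by exists (comma_mk a b ab); apply: comma_hom_eq.
Qed.

Lemma comma_cokernel (x y q : comma T) (f : hom x y) (p : hom y q) :
  is_cokernel (val f).1 (val p).1 -> is_cokernel (val f).2 (val p).2 ->
  is_cokernel f p.
Proof.
move=> p1 p2; apply: is_cokernelI.
- move=> z g h igh; apply: comma_hom_eq.
    by apply: (cokernel_epi p1); apply: (comma_eq1 igh).
  by apply: (cokernel_epi p2); apply: (comma_eq2 igh).
- by apply: comma_hom_eq => /=; [case: p1 | case: p2].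
move=> z u uf.
have [a aE] := cokernel_desc p1 (comma_eq1 uf).
have [b bE] := cokernel_desc p2 (comma_eq2 uf).
have ab : cmap z \oc fmor T b = a \oc cmap q.
  apply: (right_exact_epi BA TR (cokernel_epi p2)).
  by rewrite -compA -fmorM bE -compA !comma_homP compA aE.
by exists (comma_mk a b ab); apply: comma_hom_eq.
Qed.

Lemma comma_has_kernel (x y : comma T) (f : hom x y) :
  exists k (i : hom k x), [/\ is_kernel f i, is_kernel (val f).1 (val i).1 &
                              is_kernel (val f).2 (val i).2].
Proof.
have [K1 [k1 k1P]] := ab_kernel AA (val f).1.
have [K2 [k2 k2P]] := ab_kernel BA (val f).2.
have [|c cE] := @kernel_lift _ _ _ _ _ _ _ (cmap x \oc fmor T k2) k1P.
  by rewrite compA -comma_homP -compA -fmorM (proj1 k2P) fmor0 compm0.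
exists (CommaObj c : comma T), (@comma_mk _ _ _ (CommaObj c) x k1 k2 (esym cE)).
by split=> //; apply: comma_kernel.
Qed.

Lemma comma_has_cokernel (x y : comma T) (f : hom x y) :
  exists q (p : hom y q), [/\ is_cokernel f p,
    is_cokernel (val f).1 (val p).1 & is_cokernel (val f).2 (val p).2].
Proof.
have [Q1 [q1 q1P]] := ab_cokernel AA (val f).1.
have [Q2 [q2 q2P]] := ab_cokernel BA (val f).2.
have Tq2 := right_exact_cokernel BA AA TR q2P.
have [|c cE] := @cokernel_desc _ _ _ _ _ _ _ (q1 \oc cmap y) Tq2.
  by rewrite -compA comma_homP compA (proj1 q1P) comp0m.
exists (CommaObj c : comma T), (@comma_mk _ _ _ y (CommaObj c) q1 q2 cE).
by split=> //; apply: comma_cokernel.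
Qed.

Lemma comma_mono (x y : comma T) (f : hom x y) :
  mono f -> mono (val f).1 /\ mono (val f).2.
Proof.
move=> fM; split; apply: monoP => Z g fg.
  have g0 : cmap x \oc fmor T 0 = g \oc cmap (comma_left Z).
    by rewrite fmor0 !compm0.
  apply: (comma_eq1 (f := @comma_mk _ _ _ (comma_left Z) x g 0 g0) (g := 0)).
  apply: (mono0 fM).
  by apply: comma_hom_eq; rewrite /= ?compm0.
have g0 : cmap x \oc fmor T g = (cmap x \oc fmor T g) \oc cmap (comma_unit T Z).
  by rewrite compm1.
apply: (comma_eq2 (f := @comma_mk _ _ _ (comma_unit T Z) x _ g g0) (g := 0)).
apply: (mono0 fM).
apply: comma_hom_eq => //=.
by rewrite compA -comma_homP -compA -fmorM fg fmor0 compm0.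
Qed.

Lemma comma_epi (x y : comma T) (f : hom x y) :
  epi f -> epi (val f).1 /\ epi (val f).2.
Proof.
move=> fE.
have f2E : epi (val f).2.
  apply: epiP => Z g gf.
  pose z : comma T := @CommaObj A B T (zero_obj A) Z 0.
  have g0 : cmap z \oc fmor T g = 0 \oc cmap y by rewrite !comp0m.
  apply: (comma_eq2 (f := @comma_mk _ _ _ y z 0 g g0) (g := 0)).
  apply: (epi0 fE).
  by apply: comma_hom_eq => //=; rewrite comp0m.
split=> //; apply: epiP => Z g gf.
have g0 : cmap (comma_left Z) \oc fmor T 0 = g \oc cmap y.
  rewrite comp0m; apply/esym/(epi0 (right_exact_epi BA TR f2E)).
  by rewrite -compA comma_homP compA gf comp0m.
apply: (comma_eq1 (f := @comma_mk _ _ _ y (comma_left Z) g 0 g0) (g := 0)).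
apply: (epi0 fE).
by apply: comma_hom_eq => //=; rewrite comp0m.
Qed.

Lemma comma_epiI (x y : comma T) (f : hom x y) :
  epi (val f).1 -> epi (val f).2 -> epi f.
Proof.
move=> f1 f2 z g h gh; apply: comma_hom_eq.
  by apply: f1; apply: (comma_eq1 gh).
by apply: f2; apply: (comma_eq2 gh).
Qed.

Lemma comma_abelian : abelian (comma T).
Proof.
split.
- exists (comma_left (zero_obj A)) => x; split=> f; apply: comma_hom_eq => /=.
  + exact: (@zero_objP A _).1.
  + exact: zero_objl.
  + exact: (@zero_objP A _).2.
  + exact: zero_objr.
- move=> x y.
  have [Z1 [i1 [j1 [p1 [q1 [pi1 qj1 pj1 qi1 E1]]]]]] :=
    ab_biproduct AA (cfst x) (cfst y).
  have [Z2 [i2 [j2 [p2 [q2 [pi2 qj2 pj2 qi2 E2]]]]]] :=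
    ab_biproduct BA (csnd x) (csnd y).
  pose c : hom (T Z2) Z1 :=
    i1 \oc cmap x \oc fmor T p2 + j1 \oc cmap y \oc fmor T q2.
  pose z : comma T := CommaObj c.
  have hi : cmap z \oc fmor T i2 = i1 \oc cmap x.
    by rewrite /= compDl -!compA -!fmorM pi2 qi2 fmor0 fmor1 !compm0 addr0 compm1.
  have hj : cmap z \oc fmor T j2 = j1 \oc cmap y.
    by rewrite /= compDl -!compA -!fmorM pj2 qj2 fmor0 fmor1 !compm0 add0r compm1.
  have hp : cmap x \oc fmor T p2 = p1 \oc cmap z.
    by rewrite /= compDr !compA pi1 pj1 !comp0m addr0 comp1m.
  have hq : cmap y \oc fmor T q2 = q1 \oc cmap z.
    by rewrite /= compDr !compA qi1 qj1 !comp0m add0r comp1m.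
  exists z, (@comma_mk _ _ _ x z _ _ hi), (@comma_mk _ _ _ y z _ _ hj),
    (@comma_mk _ _ _ z x _ _ hp), (@comma_mk _ _ _ z y _ _ hq).
  by split; apply: comma_hom_eq.
- by move=> x y f; have [k [i [fi _ _]]] := comma_has_kernel f; exists k, i.
- by move=> x y f; have [q [p [fp _ _]]] := comma_has_cokernel f; exists q, p.
- move=> x y f /comma_mono[f1 f2].
  have [q [p [_ p1 p2]]] := comma_has_cokernel f; exists q, p.
  by apply: comma_kernel; apply: kernel_of_cokernel.
move=> x y f /comma_epi[f1 f2].
have [k [i [_ i1 i2]]] := comma_has_kernel f; exists k, i.
by apply: comma_cokernel; apply: cokernel_of_kernel.
Qed.

Definition comma_cat : abelianCat := AbelianCat comma_abelian.

Lemma comma_enough_projectives :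
  enough_projectives A -> enough_projectives B -> enough_projectives comma_cat.
Proof.
move=> AP BP x.
have [P [p [Pp pE]]] := AP (cfst x); have [Q [q [Qp qE]]] := BP (csnd x).
have [Z [i [j [r [s [ri sj rj si ij]]]]]] := ab_biproduct AA P (T Q).
pose z : comma T := CommaObj j.
have hz : cmap x \oc fmor T q = (p \oc r + cmap x \oc fmor T q \oc s) \oc cmap z.
  by rewrite /= compDl -!compA rj sj !compm0 compm1 add0r.
exists z, (@comma_mk _ _ _ z x _ _ hz); split; last first.
  apply: comma_epiI => //=; apply: epiP => W g.
  move=> /(congr1 (fun u => u \oc i)); rewrite comp0m -compA compDl.
  by rewrite -!compA ri si !compm0 compm1 addr0 => /(epi0 pE).
move=> u v e f /comma_epi[e1 e2].
have [a aE] := Pp _ _ _ ((val f).1 \oc i) e1.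
have [b bE] := Qp _ _ _ (val f).2 e2.
have hg : cmap u \oc fmor T b = (a \oc r + cmap u \oc fmor T b \oc s) \oc cmap z.
  by rewrite /= compDl -!compA rj sj !compm0 compm1 add0r.
exists (@comma_mk _ _ _ z u _ _ hg); apply: comma_hom_eq => //=.
rewrite compDr !compA aE -comma_homP -[X in X \oc s]compA -fmorM bE.
by rewrite (comma_homP f) -!compA -compDr ij compm1.
Qed.

End CommaAbelian.

Arguments Ext {C} CP n X N.
Arguments left_derived {C D} CP T n Y.
Arguments comma_cat {A B T} TR.
Arguments comma_enough_projectives {A B T} TR AP BP.
Arguments comma_left {A B} T X.
Arguments comma_unit {A B} T Y.

(* Main.v *)
From HB Require Import structures.
From mathcomp Require Import all_boot all_algebra.
From mathcomp Require Import boolp.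
Require Import Defs.

(** Both parts are instances of one statement about an adjunction [F -| G] of
    additive functors between abelian categories ([Ext_adjunction]).  Suppose
    that [G] preserves epimorphisms, so that [F] preserves projectives, and let
    [R -> X] be the projective resolution that defines [Ext^*(X, -)].  If
    [F R -> F X] is exact in degrees at most [j], then it is a resolution of
    [F X] as far as [Ext^j] can see, and the adjunction isomorphisms
    [Hom(F R, N) = Hom(R, G N)] give [Ext^j(F X, N) = Ext^j(X, G N)].

    The functor [X |-> (X, 0)] is left adjoint to the first component and is
    exact, which gives (1) in all degrees.  The functor [Y |-> (T Y, Y)] is left
    adjoint to the second component.  It carries [R -> Y] to a sequence that is
    exact in the second component; in the first component the sequence is
    [T R -> T Y], whose homology is [L_i T Y] for [i >= 1] and which is exact at
    its end because [T] is right exact.  This gives (2).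

    The remaining point is that [Ext^j] may be computed from a complex of
    projectives that is exact in degrees at most [j] only
    ([comparison_cohomology]).  This is the usual comparison of resolutions,
    carried out one degree at a time: [comparison_at] keeps just the two
    components of the chain maps and the one component of the homotopies from
    which the next ones are lifted, so that no infinite chain map has to be
    chosen. *)

Set Implicit Arguments.
Unset Strict Implicit.
Unset Printing Implicit Defensive.

Import GRing.Theory.
Local Open Scope ring_scope.

(** * Isomorphisms of cohomology groups *)

Lemma group_iso_trans (U V W : zmodType) :
  group_iso U V -> group_iso V W -> group_iso U W.
Proof.
move=> [f fB] [g gB]; exists (g \o f : {additive U -> W}).
exact: bij_comp gB fB.
Qed.

Lemma injective_surjective_iso (U V : zmodType) (f : {additive U -> V}) :
  injective f -> (forall v, exists u, f u = v) -> group_iso U V.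
Proof.
move=> fI fS; exists f; exists (fun v => projT1 (cid (fS v))) => [u|v].
  by apply: fI; apply: projT2 (cid (fS (f u))).
exact: projT2 (cid (fS v)).
Qed.

Lemma cohomology_eqP (U V W : zmodType) (f : {additive U -> V})
    (g : {additive V -> W}) (x y : cocycle g) :
  reflect (exists u, f u = val x - val y)
    (\pi_(group_cohomology f g)%qT x == \pi_(group_cohomology f g)%qT y).
Proof. by rewrite -Quotient.idealrBE unfold_in; apply: asboolP. Qed.

Section CohomologyIso.
Variables (U V W : zmodType) (f : {additive U -> V}) (g : {additive V -> W}).
Variables (U' V' W' : zmodType).
Variables (f' : {additive U' -> V'}) (g' : {additive V' -> W'}).
Variable phi : {additive V -> V'}.
Hypothesis phi_cocycle : forall v, g v = 0 -> g' (phi v) = 0.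

Let H := group_cohomology f g.
Let H' := group_cohomology f' g'.

Definition cocycle_map (z : cocycle g) : cocycle g' :=
  exist _ (phi (val z)) (introT eqP (phi_cocycle (eqP (valP z)))).

Lemma cocycle_map_is_zmod_morphism : zmod_morphism cocycle_map.
Proof. by move=> x y; apply: val_inj; rewrite /= !raddfB. Qed.

HB.instance Definition _ := GRing.isZmodMorphism.Build (cocycle g) (cocycle g')
  cocycle_map cocycle_map_is_zmod_morphism.

Definition cohomology_map (x : H) : H' := \pi_H'%qT (cocycle_map (repr x)).

(** A map that is invertible on classes of cocycles, without being invertible on
    cocycles. *)
Lemma cohomology_iso :
  (forall v, g v = 0 -> (exists u, f u = v) <-> (exists u, f' u = phi v)) ->
  (forall v', g' v' = 0 ->
     exists2 v, g v = 0 & exists u, f' u = phi v - v') ->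
  group_iso H H'.
Proof.
move=> phi_cobound phi_onto.
have eqE (x y : cocycle g) :
    (\pi_H%qT x == \pi_H%qT y) =
    (\pi_H'%qT (cocycle_map x) == \pi_H'%qT (cocycle_map y)).
  have gxy : g (val x - val y) = 0.
    by rewrite raddfB (eqP (valP x)) (eqP (valP y)) subrr.
  by apply/cohomology_eqP/cohomology_eqP; rewrite /= -raddfB;
     case: (phi_cobound _ gxy).
have mapE z : cohomology_map (\pi_H%qT z) = \pi_H'%qT (cocycle_map z).
  by apply/eqP; rewrite /cohomology_map -eqE reprK.
have mapB : zmod_morphism cohomology_map.
  move=> x y; rewrite -[x]reprK -[y]reprK -raddfB !mapE.
  by rewrite !raddfB.
pose mapM := GRing.isZmodMorphism.Build H H' cohomology_map mapB.
pose map : {additive H -> H'} := HB.pack cohomology_map mapM.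
apply: (@injective_surjective_iso _ _ map) => [x y|y].
  by rewrite -[x]reprK -[y]reprK /= !mapE => /eqP; rewrite -eqE => /eqP.
have [v gv [u fu]] := phi_onto _ (eqP (valP (repr y))).
exists (\pi_H%qT (exist _ v (introT eqP gv) : cocycle g)).
rewrite /= mapE -[y]reprK; apply/eqP/cohomology_eqP; exists u.
exact: fu.
Qed.

End CohomologyIso.

(** * Exact sequences in an abelian category *)

Section Exactness.
Variable C : abelianCat.
Implicit Types X Y Z : C.

(** If [z] kills [e], then [f] factors through [k \oc l], where [l] is the kernel
    of [z]; as the monomorphism [k \oc l] is a kernel, it already contains the
    image [k] of [f], so that [l] is split epi and [z = 0]. *)
Lemma image_factor_epi X Y K (f : hom X Y) (k : hom K Y) (e : hom X K) :
  is_image f k -> k \oc e = f -> epi e.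
Proof.
move=> [Q [q [fq qk]]] ke; apply: epiP => Z z ze.
have [L [l zl]] := ab_kernel (acatP C) z.
have [e' le] := kernel_lift zl ze.
have kM := kernel_mono qk; have lM := kernel_mono zl.
have klM : mono (k \oc l).
  by move=> W g h; rewrite -!compA => /kM /lM.
have [W [g gkl]] := ab_normal_mono (acatP C) klM.
have [|g' gE] := @cokernel_desc _ _ _ _ _ _ _ g fq.
  by rewrite -ke -le compA compA -(compA g) (proj1 gkl) comp0m.
have [|y yE] := @kernel_lift _ _ _ _ _ _ _ k gkl.
  by rewrite -gE -compA (proj1 qk) compm0.
have ly : l \oc y = idm K by apply: kM; rewrite compA yE compm1.
by rewrite -[z]compm1 -ly compA (proj1 zl) comp0m.
Qed.

Lemma exact_lift X Y Z P (f : hom X Y) (g : hom Y Z) (x : hom P Y) :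
  exact f g -> projective P -> g \oc x = 0 -> exists y : hom P X, f \oc y = x.
Proof.
move=> fg Pp gx; have gf := exact_comp0 fg.
case: fg => K [k [fk gk]].
have [e ke] := kernel_lift gk gf; have [x' kx] := kernel_lift gk gx.
have [y ey] := Pp _ _ _ x' (image_factor_epi fk ke).
by exists y; rewrite -ke -compA ey.
Qed.

Lemma exact_kernel_cokernel X Y Z K Q (f : hom X Y) (g : hom Y Z)
    (k : hom K Y) (q : hom Y Q) :
  exact f g -> is_kernel g k -> is_cokernel f q -> is_kernel q k.
Proof.
move=> [K' [k' [[Q' [q' [fq' qk']]] gk']]] gk fq.
apply: is_kernelI; first exact: kernel_mono gk.
  have [y <-] := kernel_lift gk' (proj1 gk).
  have [z <-] := cokernel_desc fq' (proj1 fq).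
  by rewrite compA -(compA z) (proj1 qk') compm0 comp0m.
move=> W x qx; apply: (kernel_lift gk).
have [z zq] := cokernel_desc fq (proj1 fq').
have [|w <-] := @kernel_lift _ _ _ _ _ _ _ x qk'.
  by rewrite -zq -compA qx compm0.
by rewrite compA (proj1 gk') comp0m.
Qed.

Lemma exact_of_zero_homology X Y Z (f : hom X Y) (g : hom Y Z)
    (gf : g \oc f = 0) :
  is_zero (homology gf) -> exact f g.
Proof.
move=> H0; rewrite -(cycle_liftP gf).
apply: exact_cover (acatP C) (kernelP g) _.
apply: epiP => W w wc.
have [w' <-] := cokernel_desc (cokernelP (cycle_lift gf)) wc.
by rewrite ((H0 W).2 w') comp0m.
Qed.

Lemma exact_zero X Y Z (f : hom X Y) (g : hom Y Z) : is_zero Y -> exact f g.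
Proof.
move=> Y0.
have idK V (h : hom Y V) : is_kernel h (idm Y).
  apply: is_kernelI; first by move=> W x y; rewrite !comp1m.
    by rewrite ((Y0 V).2 h) comp0m.
  by move=> W x _; exists x; rewrite comp1m.
exists Y, (idm Y); split=> //; exists Y, 0; split=> //.
apply: is_cokernelI; [|exact: comp0m|].
  by move=> W x y _; rewrite ((Y0 W).2 x) ((Y0 W).2 y).
by move=> W x _; exists 0; rewrite ((Y0 W).2 x) comp0m.
Qed.

End Exactness.

(** * Comparison of partial resolutions *)

Section Comparison.
Variable C : abelianCat.

(** A sequence [... -> P 2 -> P 1 -> P 0 -> 0] with [P 1, P 2, ...] projective,
    in which [P 0] plays the role of the object that is being resolved. *)
Definition partial_resolution (m : nat) (P : nat -> C)
    (d : forall i, hom (P i.+1) (P i)) : Prop :=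
  [/\ epi (d 0), forall i, projective (P i.+1) &
      forall i, (i <= m)%N -> exact (d i.+1) (d i)].

(** What has to be known of chain maps [f : P -> Q], [g : Q -> P] and of
    homotopies [g f ~ 1], [f g ~ 1] in order to extend them past the degree [i].
    The last two equations say that [g f - 1 - d s] and [f g - 1 - e t] vanish
    on boundaries, as they do when they are [s d] and [t e] for the homotopies
    one degree lower. *)
Definition comparison_at (P Q : nat -> C) (d : forall i, hom (P i.+1) (P i))
    (e : forall i, hom (Q i.+1) (Q i)) (i : nat) : Prop :=
  exists (f0 : hom (P i) (Q i)) (f1 : hom (P i.+1) (Q i.+1))
    (g0 : hom (Q i) (P i)) (g1 : hom (Q i.+1) (P i.+1))
    (s : hom (P i) (P i.+1)) (t : hom (Q i) (Q i.+1)),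
  [/\ e i \oc f1 = f0 \oc d i, d i \oc g1 = g0 \oc e i,
      (g0 \oc f0 - idm _ - d i \oc s) \oc d i = 0 &
      (f0 \oc g0 - idm _ - e i \oc t) \oc e i = 0].

Lemma extend_chain_map (P2 P1 P0 Q2 Q1 Q0 : C)
    (d1 : hom P2 P1) (d0 : hom P1 P0) (e1 : hom Q2 Q1) (e0 : hom Q1 Q0)
    (f0 : hom P0 Q0) (f1 : hom P1 Q1) :
  projective P2 -> d0 \oc d1 = 0 -> exact e1 e0 -> e0 \oc f1 = f0 \oc d0 ->
  exists f2 : hom P2 Q2, e1 \oc f2 = f1 \oc d1.
Proof.
move=> Pp dd e10 ef; apply: (exact_lift e10) => //.
by rewrite compA ef -compA dd compm0.
Qed.

Lemma extend_homotopy (P2 P1 P0 : C) (d1 : hom P2 P1) (d0 : hom P1 P0)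
    (h0 : hom P0 P0) (h1 : hom P1 P1) (s : hom P0 P1) :
  projective P1 -> exact d1 d0 -> d0 \oc h1 = h0 \oc d0 ->
  (h0 - idm _ - d0 \oc s) \oc d0 = 0 ->
  exists s' : hom P1 P2, d1 \oc s' = h1 - idm _ - s \oc d0.
Proof.
move=> Pp d10 dh hs; apply: (exact_lift d10) => //.
by rewrite !compBr dh compm1 -[RHS]hs !compBl comp1m compA.
Qed.

Variables (m : nat) (P Q : nat -> C).
Variables (d : forall i, hom (P i.+1) (P i)) (e : forall i, hom (Q i.+1) (Q i)).
Hypotheses (PR : partial_resolution m d) (QR : partial_resolution m e).

Lemma comparison_at0 (u : hom (P 0) (Q 0)) (v : hom (Q 0) (P 0)) :
  v \oc u = idm _ -> u \oc v = idm _ -> comparison_at d e 0.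
Proof.
have [dE Pp _] := PR; have [eE Qp _] := QR.
move=> vu uv.
have [f1 f1E] := Pp 0%N _ _ _ (u \oc d 0) eE.
have [g1 g1E] := Qp 0%N _ _ _ (v \oc e 0) dE.
exists u, f1, v, g1, 0, 0; split=> //.
  by rewrite vu subrr sub0r compNl compm0 comp0m oppr0.
by rewrite uv subrr sub0r compNl compm0 comp0m oppr0.
Qed.

Lemma comparison_atS i :
  (i <= m)%N -> comparison_at d e i -> comparison_at d e i.+1.
Proof.
have [_ Pp Pex] := PR; have [_ Qp Qex] := QR.
move=> im [f0 [f1 [g0 [g1 [s [t [ef dg hs ht]]]]]]].
have dE := Pex i im; have eE := Qex i im.
have [f2 f2E] := extend_chain_map (Pp i.+1) (exact_comp0 dE) eE ef.
have [g2 g2E] := extend_chain_map (Qp i.+1) (exact_comp0 eE) dE dg.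
have dgf : d i \oc (g1 \oc f1) = (g0 \oc f0) \oc d i.
  by rewrite compA dg -compA ef compA.
have efg : e i \oc (f1 \oc g1) = (f0 \oc g0) \oc e i.
  by rewrite compA ef -compA dg compA.
have [s' s'E] := extend_homotopy (Pp i) dE dgf hs.
have [t' t'E] := extend_homotopy (Qp i) eE efg ht.
exists f1, f2, g1, g2, s', t'; split=> //.
  by rewrite s'E subKr -compA (exact_comp0 dE) compm0.
by rewrite t'E subKr -compA (exact_comp0 eE) compm0.
Qed.

Lemma comparison_at_le i (u : hom (P 0) (Q 0)) (v : hom (Q 0) (P 0)) :
  v \oc u = idm _ -> u \oc v = idm _ -> (i <= m.+1)%N -> comparison_at d e i.
Proof.
move=> vu uv; elim: i => [_|i IH im]; first exact: comparison_at0 vu uv.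
by apply: comparison_atS => //; apply/IH/ltnW.
Qed.

(** Precomposition with the chain map [P -> Q]; the components of the homotopies
    around the degree in question show that it is invertible on classes. *)
Lemma comparison_cohomology i (u : hom (P 0) (Q 0)) (v : hom (Q 0) (P 0)) N :
  v \oc u = idm _ -> u \oc v = idm _ -> (i <= m)%N ->
  group_iso (group_cohomology (precomp N (e i)) (precomp N (e i.+1)))
            (group_cohomology (precomp N (d i)) (precomp N (d i.+1))).
Proof.
have [_ Pp Pex] := PR; have [_ Qp Qex] := QR.
move=> vu uv im; have dE := Pex i im; have eE := Qex i im.
have [f0 [f1 [g0 [g1 [s [t [ef dg hs ht]]]]]]] :=
  comparison_at_le vu uv (leqW im).
have [f2 f2E] := extend_chain_map (Pp i.+1) (exact_comp0 dE) eE ef.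
have [g2 g2E] := extend_chain_map (Qp i.+1) (exact_comp0 eE) dE dg.
have dgf : d i \oc (g1 \oc f1) = (g0 \oc f0) \oc d i.
  by rewrite compA dg -compA ef compA.
have efg : e i \oc (f1 \oc g1) = (f0 \oc g0) \oc e i.
  by rewrite compA ef -compA dg compA.
have [s' s'E] := extend_homotopy (Pp i) dE dgf hs.
have [t' t'E] := extend_homotopy (Qp i) eE efg ht.
have cocycle_f (w : hom (Q i.+1) N) :
    precomp N (e i.+1) w = 0 -> precomp N (d i.+1) (precomp N f1 w) = 0.
  by rewrite /precomp -compA -f2E compA => ->; rewrite comp0m.
apply: (cohomology_iso (phi := precomp N f1) cocycle_f); rewrite /= /precomp.
  move=> w we; split=> [[x xe]|[x xd]].
    by exists (x \oc f0); rewrite -xe -compA -ef compA.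
  (* [f g - t e = 1 + e t'] and [w] kills boundaries, so [w = w f g - w t e]. *)
  exists (x \oc g0 - w \oc t); rewrite compBl -compA -dg compA xd -!compA.
  have fg1 : f1 \oc g1 - t \oc e i = e i.+1 \oc t' + idm _.
    by rewrite t'E addrAC subrK.
  by rewrite -compBr fg1 compDr compm1 compA we comp0m add0r.
move=> w wd; exists (w \oc g1); first by rewrite -compA -g2E compA wd comp0m.
exists (w \oc s).
have gf1 : g1 \oc f1 - idm _ = d i.+1 \oc s' + s \oc d i by rewrite s'E subrK.
rewrite -!compA -{3}[w]compm1 -compBr gf1.
by rewrite compDr (compA w (d i.+1)) wd comp0m add0r.
Qed.

End Comparison.

(** * Ext and adjunctions *)

Record adjunction (C D : preadditive) (F : additive_functor C D)
    (G : additive_functor D C) := Adjunction {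
  adj_unit : forall X, hom X (G (F X));
  adj_counit : forall N, hom (F (G N)) N;
  adj_unitN : forall X Y (f : hom X Y),
    adj_unit Y \oc f = fmor G (fmor F f) \oc adj_unit X;
  adj_counitN : forall M N (f : hom M N),
    f \oc adj_counit M = adj_counit N \oc fmor F (fmor G f);
  adj_unit_counit : forall X,
    adj_counit (F X) \oc fmor F (adj_unit X) = idm (F X);
  adj_counit_unit : forall N,
    fmor G (adj_counit N) \oc adj_unit (G N) = idm (G N) }.

Section AdjunctionTheory.
Variables (C D : preadditive).
Variables (F : additive_functor C D) (G : additive_functor D C).
Variable FG : adjunction F G.

Definition transpose X N (f : hom (F X) N) : hom X (G N) :=
  fmor G f \oc adj_unit FG X.

Definition untranspose X N (f : hom X (G N)) : hom (F X) N :=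
  adj_counit FG N \oc fmor F f.

Fact transpose_is_zmod_morphism X N : zmod_morphism (@transpose X N).
Proof. by move=> f g; rewrite /transpose fmorD fmorN compBl. Qed.

HB.instance Definition _ X N := GRing.isZmodMorphism.Build
  (hom (F X) N) (hom X (G N)) (@transpose X N)
  (@transpose_is_zmod_morphism X N).

Lemma transposeK X N : cancel (@transpose X N) (@untranspose X N).
Proof.
move=> f; rewrite /untranspose /transpose fmorM compA -adj_counitN -compA.
by rewrite adj_unit_counit compm1.
Qed.

Lemma untransposeK X N : cancel (@untranspose X N) (@transpose X N).
Proof.
move=> f; rewrite /untranspose /transpose fmorM -compA -adj_unitN compA.
by rewrite adj_counit_unit comp1m.
Qed.

Lemma transpose_comp X Y N (f : hom (F Y) N) (g : hom X Y) :
  transpose (f \oc fmor F g) = transpose f \oc g.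
Proof. by rewrite /transpose fmorM -!compA adj_unitN. Qed.

Lemma untranspose_comp X M N (f : hom M N) (g : hom X (G M)) :
  untranspose (fmor G f \oc g) = f \oc untranspose g.
Proof. by rewrite /untranspose fmorM !compA adj_counitN. Qed.

Lemma left_adjoint_epi X Y (e : hom X Y) : epi e -> epi (fmor F e).
Proof.
move=> eE N g h geh; apply: (can_inj (@transposeK Y N)); apply: eE.
by rewrite -!transpose_comp geh.
Qed.

Lemma left_adjoint_projective P :
  (forall M N (e : hom M N), epi e -> epi (fmor G e)) ->
  projective P -> projective (F P).
Proof.
move=> GE Pp M N e f eE; have [g gE] := Pp _ _ _ (transpose f) (GE _ _ _ eE).
by exists (untranspose g); rewrite -untranspose_comp gE transposeK.
Qed.

End AdjunctionTheory.

Section AugmentedResolution.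
Variables (C : preadditive) (X : C) (R : projective_resolution X).

Definition augmented (i : nat) : C := if i is j.+1 then R j else X.

Definition augmented_d (i : nat) : hom (augmented i.+1) (augmented i) :=
  match i return hom (augmented i.+1) (augmented i) with
  | 0 => pr_aug R
  | j.+1 => pr_d R j
  end.

Lemma augmented_exact i : exact (augmented_d i.+1) (augmented_d i).
Proof. by case: i => [|i]; [exact: pr_exact0 | exact: pr_exact]. Qed.

End AugmentedResolution.

Lemma augmented_partial_resolution (C : abelianCat) (X : C)
    (R : projective_resolution X) m :
  partial_resolution m (augmented_d R).
Proof.
by split=> [|i|i _]; [exact: pr_epi | exact: pr_projective
                     | exact: augmented_exact].
Qed.

Section ExtAdjunction.
Variables (C D : abelianCat).
Variables (CP : enough_projectives C) (DP : enough_projectives D).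
Variables (F : additive_functor C D) (G : additive_functor D C).
Variable FG : adjunction F G.
Hypothesis GE : forall M N (e : hom M N), epi e -> epi (fmor G e).

Lemma adjunction_cohomology (X Y Z : C) (d : hom Y X) (d' : hom Z Y) (N : D) :
  group_iso
    (group_cohomology (precomp N (fmor F d)) (precomp N (fmor F d')))
    (group_cohomology (precomp (G N) d) (precomp (G N) d')).
Proof.
have cocycle_tr (v : hom (F Y) N) :
    precomp N (fmor F d') v = 0 -> precomp (G N) d' (transpose FG v) = 0.
  by rewrite /precomp -transpose_comp => ->; rewrite raddf0.
apply: (cohomology_iso (phi := @transpose _ _ _ _ FG Y N) cocycle_tr);
  rewrite /= /precomp.
  move=> v vd; split=> [[u <-]|[u ud]].
    by exists (transpose FG u); rewrite transpose_comp.
  exists (untranspose FG u); apply: (can_inj (@transposeK _ _ _ _ FG Y N)).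
  by rewrite transpose_comp untransposeK.
move=> v vd; exists (untranspose FG v).
  apply: (can_inj (@transposeK _ _ _ _ FG Z N)).
  by rewrite transpose_comp untransposeK vd raddf0.
by exists 0; rewrite comp0m untransposeK subrr.
Qed.

(** For [Ext^(j+1)] the image of the resolution has to be exact up to its term
    [F (R (j+1))]; the end [F (R 0) -> F X] is epi because [F] is a left
    adjoint. *)
Theorem Ext_adjunction j (X : C) (N : D) :
  (forall i, (i <= j.+1)%N ->
     exact (fmor F (augmented_d (resolution CP X) i.+1))
           (fmor F (augmented_d (resolution CP X) i))) ->
  group_iso (Ext DP j.+1 (F X) N) (Ext CP j.+1 X (G N)).
Proof.
move=> Fex; pose R := resolution CP X.
have FR : @partial_resolution D j.+1 (fun i => F (augmented R i))
            (fun i => fmor F (augmented_d R i)).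
  split=> //; first exact: (left_adjoint_epi FG (@pr_epi _ _ R)).
  by move=> i; apply: (left_adjoint_projective FG GE); apply: pr_projective.
have QR := augmented_partial_resolution (resolution DP (F X)) j.+1.
apply: group_iso_trans (adjunction_cohomology (augmented_d R j.+1)
  (augmented_d R j.+2) N).
(* In positive degrees the deleted and the augmented complex coincide; the
   object resolved on both sides is [F X], compared by its identity. *)
exact: (comparison_cohomology FR QR N (comp1m (idm (F X))) (comp1m _)
  (leqnn j.+1)).
Qed.

End ExtAdjunction.

(** * The two adjunctions of the comma category *)

Section CommaAdjunctions.
Variables (A B : abelianCat) (T : additive_functor B A).
Hypothesis TR : right_exact T.

Definition cfst_functor : additive_functor (comma T) A.
Proof.
by apply: (@AdditiveFunctor (comma T) A (@cfst A B T) (fun x y f => (val f).1)).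
Defined.

Definition csnd_functor : additive_functor (comma T) B.
Proof.
by apply: (@AdditiveFunctor (comma T) B (@csnd A B T) (fun x y f => (val f).2)).
Defined.

Definition comma_left_mor (X Y : A) (f : hom X Y) :
  hom (comma_left T X) (comma_left T Y).
Proof.
by apply: (@comma_mk _ _ _ (comma_left T X) (comma_left T Y) f 0);
   rewrite !(comp0m, compm0).
Defined.

Definition comma_left_functor : additive_functor A (comma T).
Proof.
apply: (@AdditiveFunctor A (comma T) (comma_left T) comma_left_mor).
- by move=> X; apply: comma_hom_eq => //=; rewrite [RHS]zero_objl.
- by move=> X Y Z g f; apply: comma_hom_eq => //=; rewrite comp0m.
- by move=> X Y f g; apply: comma_hom_eq => //=; rewrite addr0.
Defined.

Definition comma_unit_mor (X Y : B) (f : hom X Y) :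
  hom (comma_unit T X) (comma_unit T Y).
Proof.
by apply: (@comma_mk _ _ _ (comma_unit T X) (comma_unit T Y) (fmor T f) f);
   rewrite comp1m compm1.
Defined.

Definition comma_unit_functor : additive_functor B (comma T).
Proof.
apply: (@AdditiveFunctor B (comma T) (comma_unit T) comma_unit_mor).
- by move=> X; apply: comma_hom_eq => //=; rewrite fmor1.
- by move=> X Y Z g f; apply: comma_hom_eq => //=; rewrite fmorM.
- by move=> X Y f g; apply: comma_hom_eq => //=; rewrite fmorD.
Defined.

Definition comma_left_counit (N : comma T) : hom (comma_left T (cfst N)) N.
Proof.
by apply: (@comma_mk _ _ _ (comma_left T (cfst N)) N (idm _) 0);
   rewrite fmor0 !compm0.
Defined.

Definition comma_left_adjunction : adjunction comma_left_functor cfst_functor.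
Proof.
apply: (@Adjunction _ _ comma_left_functor cfst_functor
  (fun X => idm X) comma_left_counit).
- by move=> X Y f; rewrite comp1m compm1.
- by move=> M N f; apply: comma_hom_eq; rewrite /= ?comp1m ?compm1 ?compm0.
- move=> X; apply: comma_hom_eq; rewrite /= ?comp1m //.
  by rewrite [RHS]zero_objl comp0m.
- by move=> N; rewrite /= comp1m.
Defined.

Definition comma_unit_counit (N : comma T) : hom (comma_unit T (csnd N)) N.
Proof.
by apply: (@comma_mk _ _ _ (comma_unit T (csnd N)) N (cmap N) (idm _));
   rewrite fmor1.
Defined.

Definition comma_unit_adjunction : adjunction comma_unit_functor csnd_functor.
Proof.
apply: (@Adjunction _ _ comma_unit_functor csnd_functor
  (fun Y => idm Y) comma_unit_counit).
- by move=> X Y f; rewrite comp1m compm1.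
- move=> M N f; apply: comma_hom_eq; rewrite /= ?comp1m ?compm1 //.
  by rewrite -comma_homP.
- by move=> X; apply: comma_hom_eq; rewrite /= ?fmor1 comp1m.
- by move=> N; rewrite /= comp1m.
Defined.

Lemma comma_exact (x y z : comma_cat TR) (f : hom x y) (g : hom y z) :
  exact (val f).1 (val g).1 -> exact (val f).2 (val g).2 -> exact f g.
Proof.
move=> fg1 fg2.
have [k [i [gi gi1 gi2]]] := comma_has_kernel g.
have [q [p [fp fp1 fp2]]] := comma_has_cokernel TR f.
exists k, i; split=> //; exists q, p; split=> //; apply: comma_kernel.
  exact: exact_kernel_cokernel fg1 gi1 fp1.
exact: exact_kernel_cokernel fg2 gi2 fp2.
Qed.

Lemma comma_left_exact (X Y Z : A) (f : hom X Y) (g : hom Y Z) :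
  exact f g ->
  @exact (comma_cat TR) _ _ _ (comma_left_mor f) (comma_left_mor g).
Proof. by move=> fg; apply: comma_exact => //=; apply/exact_zero/zero_objP. Qed.

Lemma comma_unit_exact (X Y Z : B) (f : hom X Y) (g : hom Y Z) :
  exact f g -> exact (fmor T f) (fmor T g) ->
  @exact (comma_cat TR) _ _ _ (comma_unit_mor f) (comma_unit_mor g).
Proof. by move=> fg Tfg; apply: comma_exact. Qed.

(** Right exactness settles the end of the sequence, and the homology further
    left is [L_i T Y]. *)
Lemma fmor_augmented_exact (BP : enough_projectives B) (Y : B) m :
  (forall i, (1 <= i <= m)%N -> is_zero (left_derived BP T i Y)) ->
  forall i, (i <= m)%N ->
    exact (fmor T (augmented_d (resolution BP Y) i.+1))
          (fmor T (augmented_d (resolution BP Y) i)).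
Proof.
move=> LT0 [|i] im.
  exact: (TR (pr_exact0 _) (@pr_epi _ _ (resolution BP Y))).1.
exact: (exact_of_zero_homology (LT0 i.+1 im)).
Qed.

End CommaAdjunctions.

Theorem lemma3p5 (A B : abelianCat)
    (AP : enough_projectives A) (AI : enough_injectives A)
    (BP : enough_projectives B) (BI : enough_injectives B)
    (T : additive_functor B A) (TR : right_exact T)
    (n : nat) (n_ge1 : (1 <= n)%N) :
  (forall (X : A) (N : comma_cat TR),
     group_iso
       (Ext (comma_enough_projectives TR AP BP) n
          (comma_left T X) N)
       (Ext AP n X (cfst N)))
  /\
  (forall (Y : B) (X : comma_cat TR),
     (forall j : nat, (1 <= j <= n)%N -> is_zero (left_derived BP T j Y)) ->
     forall j : nat, (1 <= j <= n)%N ->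
     group_iso
       (Ext (comma_enough_projectives TR AP BP) j
          (comma_unit T Y) X)
       (Ext BP j Y (csnd X))).
Proof.
split=> [X N|Y X LT0].
  case: n n_ge1 => // m _.
  apply: (@Ext_adjunction A (comma_cat TR) AP _ (comma_left_functor T)
    (cfst_functor T) (comma_left_adjunction T)).
    by move=> x y e /(comma_epi TR) [].
  by move=> i _; apply: comma_left_exact; apply: augmented_exact.
case=> // m /= mn.
apply: (@Ext_adjunction B (comma_cat TR) BP _ (comma_unit_functor T)
  (csnd_functor T) (comma_unit_adjunction T)).
  by move=> x y e /(comma_epi TR) [].
move=> i im; apply: comma_unit_exact; first exact: augmented_exact.
exact: (fmor_augmented_exact TR LT0 (leq_trans im mn)).
Qed.
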